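(* Let $a,b:[0,\infty)\to\mathbb{R}$ be Lebesgue measurable and essentially bounded, and suppose there are constants $\alpha,\beta$ with $a(t)\ge\alpha>0$ and $b(t)\ge\beta>0$. If the fundamental function $X(t,s)$ of the equation $\ddot x(t)+a(t)\dot x(t)+b(t)x(t)=0$ is positive (i.e. $X(t,s)>0$ for $t>s\ge 0$), then this equation is exponentially stable.
   Context: Inequalities between coefficients are understood almost everywhere. The fundamental function $X(t,s)$: for each fixed $s\ge 0$, $X(\cdot,s)$ is the solution (with locally absolutely continuous derivative, equation satisfied almost everywhere) of $\ddot x+a\dot x+bx=0$ on $t\ge s$ with $x(s)=0$, $\dot x(s)=1$. The equation is called exponentially stable if there exist $K>0,\lambda>0$ such that $|X(t,s)|\le K e^{-\lambda(t-s)}$ for all $t\ge s\ge 0$. *)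

(* Defs.v *)
From HB Require Import structures.
From mathcomp Require Import all_boot all_order all_algebra.
From mathcomp Require Import all_classical all_reals all_analysis.

Set Implicit Arguments.
Unset Strict Implicit.
Unset Printing Implicit Defensive.

Import Order.TTheory GRing.Theory Num.Theory.
Import numFieldNormedType.Exports.

Local Open Scope classical_set_scope.
Local Open Scope ring_scope.

(* [measurable] on [R] is Borel.  Lebesgue measurability is measurability with
   respect to the domain of [completed_lebesgue_measure], i.e. the Caratheodory
   sigma-algebra of the Lebesgue outer measure. *)
Definition lebesgue_measurable_fun (R : realType) (D : set R) (f : R -> R) :=
  @measurable_fun _ _ (caratheodory_type ((wlength (@idfun R))^*)%mu) R D f.

Definition essentially_bounded (R : realType) (D : set R) (f : R -> R) :=
  exists M : R, {ae @lebesgue_measure R, forall t, D t -> `|f t| <= M}.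

Definition abs_continuous (R : realType) (c d : R) (f : R -> R) :=
  forall e : R, 0 < e -> exists2 delta : R, 0 < delta &
    forall (n : nat) (u v : 'I_n -> R),
      (forall i, c <= u i /\ u i <= v i /\ v i <= d) ->
      trivIset [set: 'I_n] (fun i => `]u i, v i[%classic) ->
      \sum_(i < n) (v i - u i) < delta ->
      \sum_(i < n) `|f (v i) - f (u i)| < e.

Definition locally_abs_continuous (R : realType) (I : set R) (f : R -> R) :=
  forall c d : R, `[c, d] `<=` I -> abs_continuous c d f.

(* The difference quotients only use points of [D], so the derivative is
   one-sided at an endpoint of an interval [D]. *)
Definition has_derivative_on (R : realType) (D : set R) (x v : R -> R) :=
  forall t, D t ->
    (fun r => (x r - x t) / (r - t)) @ within D t^' --> v t.

(* [v] is the derivative of [x] on [s, +oo[.  Only the values of [x] and [v]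
   on [s, +oo[ matter: the two-sided derivative of [v] is taken almost
   everywhere, so the endpoint [s] is irrelevant there. *)
Definition solves_with_velocity (R : realType) (a b : R -> R) (s : R)
    (x v : R -> R) :=
  [/\ has_derivative_on `[s, +oo[ x v,
      locally_abs_continuous `[s, +oo[ v &
      {ae @lebesgue_measure R, forall t, s <= t ->
        derivable v t 1 /\ (v^`())%classic t + a t * v t + b t * x t = 0}].

Definition is_fundamental_function (R : realType) (a b : R -> R)
    (X : R -> R -> R) :=
  forall s : R, 0 <= s ->
    exists2 v : R -> R, solves_with_velocity a b s (X ^~ s) v &
      X s s = 0 /\ v s = 1.

(* Exponential stability of the equation is a property of its fundamental
   function [X], which is determined by the coefficients on the set
   [0 <= s <= t]. *)
Definition exponentially_stable (R : realType) (X : R -> R -> R) :=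
  exists K lambda : R, [/\ 0 < K, 0 < lambda &
    forall t s : R, 0 <= s -> s <= t ->
      `|X t s| <= K * expR (- lambda * (t - s))].

(* Main.v *)
(* Fix s and write x = X(., s), v = x'; thus x > 0 on (s, oo), x(s) = 0,
   v(s) = 1.  While v > 0 the equation forces v' <= 0, so v <= 1,
   x(t) <= t - s and v(s + 1) <= x(s + 1).  If c > 0 is small (c <= alpha and
   c * sup a <= beta / 2), any affine k of slope in [- beta / 2, 0] with
   k >= - c is a barrier for the Riccati quotient v / x: the function v - k x
   has a.e. nonpositive derivative wherever it is positive, so it cannot become
   positive.  Lowering k from 1 to - c takes a time independent of s, after
   which v <= - c x, i.e. x e^(c t) is nonincreasing. *)
Require Import Defs.
From HB Require Import structures.
From mathcomp Require Import all_boot all_order all_algebra.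
From mathcomp Require Import all_classical all_reals all_analysis.
From mathcomp Require Import ring lra.
Set Implicit Arguments.
Unset Strict Implicit.
Unset Printing Implicit Defensive.

Import Order.TTheory GRing.Theory Num.Theory.
Import numFieldNormedType.Exports.
Local Open Scope classical_set_scope.
Local Open Scope ring_scope.

(** * Monotonicity from an almost everywhere nonpositive derivative *)

(* Cousin's lemma in the form of an induction over intervals. *)
Lemma segment_chain (R : realType) (P : R -> R -> Prop) (c d : R) :
  c <= d ->
  (forall u v w, c <= u -> u <= v -> v <= w -> w <= d ->
    P u v -> P v w -> P u w) ->
  (forall t, c <= t -> t <= d -> exists2 eta, 0 < eta & forall u v,
    c <= u -> u <= t -> t <= v -> v <= d -> v - u < eta -> P u v) ->
  P c d.
Proof.
move=> cd trans loc.
pose S := [set t | [/\ c <= t, t <= d & P c t]].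
have Sc : S c.
  split=> //; have [eta eta0 H] := loc c (lexx c) cd.
  by apply: H; rewrite ?subrr.
have ubS : ubound S d by move=> t [].
have hS : has_ubound S by exists d.
have supS : has_sup S by split; first by exists c.
set e := sup S.
have ce : c <= e by apply: ub_le_sup.
have ed : e <= d by apply: ge_sup => //; exists c.
have [eta eta0 H] := loc e ce ed.
have [t [ct td Pct] et] := sup_adherent eta0 supS.
have te : t <= e by apply: ub_le_sup.
have {}et : e - t < eta by rewrite ltrBlDr -ltrBlDl.
(* [r] is capped at [d] and otherwise lies strictly beyond the supremum [e], while [[t, r]] stays
   shorter than [eta]; so [r] belongs to [S], which is possible only if [r = d]. *)
set r := Num.min d (t + (e - t + eta) / 2).
have er : e <= r.
  by rewrite le_min ed /=; lra.
have rd : r <= d by rewrite ge_min lexx.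
have rt : r <= t + (e - t + eta) / 2 by rewrite ge_min lexx orbT.
have Pcr : P c r.
  apply: (trans c t r) => //; first exact: le_trans er.
  by apply: H => //; lra.
have re : r <= e by apply: ub_le_sup => //; split=> //; exact: le_trans er.
have [dr|rltd] := leP d r.
  by have -> : d = r by apply/eqP; rewrite eq_le dr rd.
move: rltd re; rewrite /r gt_min ltxx /= => h1; rewrite ge_min => /orP[|]; last lra.
by move: h1 rd; rewrite /r; lra.
Qed.

(** The one-sided increments at [t] are each at most [e] times the length, and they add up over any
    short interval straddling [t]; this is a local input for [segment_chain]. *)
Lemma derivable_increment_le (R : realType) (f : R -> R) (t e : R) :
  derivable f t 1 -> (f^`())%classic t <= 0 -> 0 < e ->
  exists2 eta, 0 < eta & forall u v, u <= t -> t <= v -> v - u < eta ->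
    f v - f u <= e * (v - u).
Proof.
move=> df f0 e0.
have /cvgrPdist_lt /(_ e e0) := df.
rewrite /nbhs/= /dnbhs /within /= -/('D_1 f t) -derive1E.
case=> eta /= eta0 H; exists eta => // u v ut tv uv.
have {}H h : `|h| < eta -> h != 0 -> (f (t + h) - f t) / h <= e.
  move=> h1 h0; have := H h; rewrite /ball_ /= sub0r normrN => /(_ h1 h0).
  rewrite /GRing.scale /= mulr1 [h + t]addrC [h^-1 * _]mulrC.
  rewrite ltr_norml => /andP[+ _]; lra.
have Hr : f v - f t <= e * (v - t).
  have := H (v - t); rewrite addrCA subrr addr0.
  have [->|vt] := eqVneq v t; first by rewrite !subrr mulr0.
  have vt0 : 0 < v - t by rewrite subr_gt0 lt_neqAle eq_sym vt.
  rewrite gtr0_norm // gt_eqF // => /(_ _ isT).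
  by rewrite ler_pdivrMr //; apply; lra.
have Hl : f t - f u <= e * (t - u).
  have := H (u - t); rewrite addrCA subrr addr0.
  have [->|vt] := eqVneq u t; first by rewrite !subrr mulr0.
  have vt0 : u - t < 0 by rewrite subr_lt0 lt_neqAle vt.
  rewrite ltr0_norm // lt_eqF // => /(_ _ isT).
  rewrite ler_ndivrMr // => h; have : e * (u - t) <= f u - f t by apply: h; lra.
  lra.
lra.
Qed.

Lemma open_segment_nbhs (R : realType) (U : set R) (t : R) : open U -> U t ->
  exists2 eta, 0 < eta & forall u v, u <= t -> t <= v -> v - u < eta ->
    `]u, v[ `<=` U.
Proof.
move=> oU Ut; have /nbhs_ballP[eta /= eta0 H] := open_nbhs_nbhs (conj oU Ut).
exists eta => // u v ut tv uv x /=; rewrite in_itv /= => /andP[ux xv].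
by apply: H; rewrite /ball /= ltr_norml; lra.
Qed.

Lemma sum_disjoint_itv_le (R : realType) (U : set R) n (u v : 'I_n -> R) :
  measurable U -> (forall i, u i <= v i) ->
  trivIset [set: 'I_n] (fun i => `]u i, v i[%classic) ->
  (forall i, `]u i, v i[ `<=` U) ->
  ((\sum_(i < n) (v i - u i))%:E <= lebesgue_measure U)%E.
Proof.
move=> mU uv tI sU.
have -> : ((\sum_(i < n) (v i - u i))%:E =
    lebesgue_measure (\big[setU/set0]_(i < n) `]u i, v i[%classic))%E.
  rewrite measure_bigsetU_ord //.
  rewrite -sumEFin; apply: eq_bigr => i _.
  rewrite [RHS](lebesgue_measure_itv `]u i, v i[) /= lte_fin.
  have [//|vu] := ltP (u i) (v i).
  by have -> : v i = u i; [apply/eqP; rewrite eq_le vu uv | rewrite subrr].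
apply: le_measure; rewrite ?inE //.
  by apply: bigsetU_measurable => i _; exact: measurable_itv.
by elim/big_ind: _ => // A B AU BU x [/AU|/BU].
Qed.

(** Links tagged outside a null set contribute at most [e] times their length by
    [derivable_increment_le]. The null set lies in an open [U] of measure below the [delta] of
    absolute continuity, so the links tagged there contribute less than [e] altogether.
    [segment_chain] glues both kinds. *)
Lemma abs_continuous_derive_le0 (R : realType) (f : R -> R) (c d : R) :
  c <= d -> abs_continuous c d f ->
  {ae @lebesgue_measure R, forall t, c < t -> t < d ->
    derivable f t 1 /\ (f^`())%classic t <= 0} ->
  f d <= f c.
Proof.
move=> cd ac [B [mB B0 subB]].
suff H e : 0 < e -> f d - f c <= e * (d - c) + e.
  apply/ler_addgt0Pr => e e0; have dc1 : 0 < d - c + 1 by lra.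
  have := H (e / (d - c + 1)) (divr_gt0 e0 dc1).
  have -> : e / (d - c + 1) * (d - c) + e / (d - c + 1) = e.
    by field; rewrite gt_eqF.
  lra.
move=> e0; have [delta delta0 acd] := ac e e0.
(* The hypothesis speaks only of the open interval, so both endpoints join the null set. *)
pose N := B `|` [set c] `|` [set d].
have mN : measurable N by apply: measurableU => //; apply: measurableU.
have N0 : lebesgue_measure N = 0%E.
  apply/eqP; rewrite -measure_le0.
  apply: (le_trans (measureU2 _ _ _)) => //; first exact: measurableU.
  rewrite [X in (_ + X <= _)%E]lebesgue_measure_set1 adde0.
  apply: (le_trans (measureU2 _ _ _)) => //.
  by rewrite [X in (_ + X <= _)%E]lebesgue_measure_set1 adde0 [leLHS]B0.
have [|U [oU NU mUN]] := lebesgue_regularity_outer mN _ delta0.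
  by rewrite [ltLHS]N0 ltry.
have mU : measurable U by exact: measurable_realfun.open_measurable.
have {mUN}Udelta : (lebesgue_measure U < delta%:E)%E.
  apply: le_lt_trans mUN; rewrite -{1}(setDUK NU).
  apply: (le_trans (measureU2 _ _ _)) => //; first exact: measurableD.
  by rewrite [X in (X + _ <= _)%E]N0 add0e.
(* [s] lists the links [(u, v)] of the chain whose tag lies in the null set;
   they lie in [U], so absolute continuity bounds their total contribution. *)
pose P u v := exists s : seq (R * R),
  [/\ pairwise (fun p q : R * R => p.2 <= q.1) s,
      all (fun p : R * R => [&& u <= p.1, p.1 <= p.2 & p.2 <= v]) s,
      forall p, p \in s -> `]p.1, p.2[ `<=` U &
      f v - f u <= e * (v - u) + \sum_(p <- s) `|f p.2 - f p.1|].
have [|t ct td|s [s1 s2 s3 s4]] := @segment_chain R P c d cd.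
- move=> u v w cu uv vw wd [s [s1 s2 s3 s4]] [r [r1 r2 r3 r4]].
  exists (s ++ r); split.
  + rewrite pairwise_cat s1 r1 !andbT; apply/allrelP => p q ps qr.
    have /and3P[_ _ pv] := allP s2 _ ps; have /and3P[vq _ _] := allP r2 _ qr.
    exact: le_trans pv vq.
  + rewrite all_cat; apply/andP; split; apply/allP => p pin.
      by have /and3P[-> -> pv] := allP s2 _ pin; rewrite /= (le_trans pv vw).
    by have /and3P[vq -> ->] := allP r2 _ pin; rewrite andbT (le_trans uv vq).
  + by move=> p; rewrite mem_cat => /orP[/s3|/r3].
  + rewrite big_cat /=; lra.
(* A tag in [N] records its link, which lies inside [U]; any other tag gives the empty list, its
   increment being covered by [e * (v - u)]. *)
- have [tN|tN] := pselect (N t).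
    have [eta eta0 H] := open_segment_nbhs oU (NU _ tN).
    exists eta => // u v cu ut tv vd uv; exists [:: (u, v)]; split => //=.
    + by rewrite !lexx (le_trans ut tv).
    + by move=> p; rewrite inE => /eqP ->; exact: H.
    + rewrite big_seq1 /= -[X in X <= _]add0r lerD ?ler_norm //.
      by rewrite mulr_ge0 ?subr_ge0 ?(le_trans ut) // ltW.
  have {}ct : c < t.
    by rewrite lt_neqAle ct andbT; apply/eqP => E; apply: tN; left; right.
  have {}td : t < d.
    by rewrite lt_neqAle td andbT; apply/eqP => E; apply: tN; right.
  have [df f0] : derivable f t 1 /\ (f^`())%classic t <= 0.
    apply: contrapT => h; apply: tN; left; left; apply: subB => /= h'.
    by apply: h; exact: h'.
  have [eta eta0 H] := derivable_increment_le df f0 e0.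
  exists eta => // u v cu ut tv vd uv; exists [::]; split => //.
  by rewrite big_nil addr0; exact: H.
(* The list is reindexed by ordinals to match [abs_continuous]; its links run from left to right, so
   the open intervals are disjoint. *)
pose u (i : 'I_(size s)) := (tnth (in_tuple s) i).1.
pose v (i : 'I_(size s)) := (tnth (in_tuple s) i).2.
have uvP i : [&& c <= u i, u i <= v i & v i <= d].
  by apply: (allP s2); exact: mem_tnth.
have sord (i j : 'I_(size s)) : (i < j)%N -> v i <= u j.
  move=> ij; rewrite /u /v !(tnth_nth (0, 0)) /=.
  by move/pairwiseP: s1 => /(_ (0, 0) i j); apply => //; rewrite inE.
have tI : trivIset [set: 'I_(size s)] (fun i => `]u i, v i[%classic).
  apply/trivIsetP => i j _ _ ij; apply/seteqP; split => // x [] /=.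
  rewrite !in_itv /= => /andP[ix xi] /andP[jx xj].
  move: ij; rewrite neq_ltn => /orP[] /sord; lra.
have sumlt : \sum_(i < size s) (v i - u i) < delta.
  rewrite -lte_fin; apply: le_lt_trans Udelta; apply: sum_disjoint_itv_le => //.
    by move=> i; have /and3P[] := uvP i.
  by move=> i; apply: s3; exact: mem_tnth.
have : \sum_(i < size s) `|f (v i) - f (u i)| < e.
  by apply: acd => // i; have /and3P[] := uvP i.
by move: s4; rewrite big_tnth /u /v; lra.
Qed.

(** * Absolutely continuous functions: continuity, Lipschitz perturbation, barriers *)

Lemma abs_continuous_uniform (R : realType) (f : R -> R) (c d e : R) :
  abs_continuous c d f -> 0 < e -> exists2 delta, 0 < delta &
    forall u v, c <= u -> u <= v -> v <= d -> v - u < delta ->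
      `|f v - f u| < e.
Proof.
move=> ac e0; have [delta delta0 H] := ac e e0.
exists delta => // u v cu uv vd uvd.
have := H 1%N (fun=> u) (fun=> v); rewrite !big_ord1; apply => //.
by apply/trivIsetP => i j _ _; rewrite !ord1 eqxx.
Qed.

Lemma abs_continuous_within_continuous (R : realType) (f : R -> R) (c d : R) :
  abs_continuous c d f -> {within `[c, d], continuous f}.
Proof.
move=> ac; apply/subspace_continuousP => t /=; rewrite in_itv /= => /andP[ct td].
apply/cvgrPdist_lt => e e0; have [delta delta0 H] := abs_continuous_uniform ac e0.
exists delta => //= u; rewrite /= ltr_norml => /andP[u1 u2].
rewrite in_itv /= => /andP[cu ud].
have [tu|ut] := leP t u; last by apply: H => //; lra.
by rewrite distrC; apply: H => //; lra.
Qed.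

Lemma abs_continuousD_lipschitz (R : realType) (f g : R -> R) (c d L : R) :
  abs_continuous c d f -> 0 <= L ->
  (forall u v, c <= u -> u <= v -> v <= d -> `|g v - g u| <= L * (v - u)) ->
  abs_continuous c d (f \+ g).
Proof.
move=> ac L0 gL e e0; have e2 : 0 < e / 2 by lra.
have [delta delta0 H] := ac _ e2.
have L1 : 0 < 2 * (L + 1) by lra.
(* Each summand gets half of [e]: total length below [e / (2 * (L + 1))] keeps the share of [g]
   under [e / 2], and the [+ 1] allows [L = 0]. *)
exists (Num.min delta (e / (2 * (L + 1)))) => [|n u v uvP tI].
  by rewrite lt_min delta0 divr_gt0.
rewrite lt_min => /andP[s1 s2].
have := H n u v uvP tI s1; set S := \sum_(i < n) _ => SP.
move: s2; rewrite ltr_pdivlMr //; set D := \sum_(i < n) _ => DP.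
suff le : \sum_(i < n) `|(f \+ g) (v i) - (f \+ g) (u i)| <= S + L * D.
  have D0 : 0 <= D.
    by apply: sumr_ge0 => i _; rewrite subr_ge0; case: (uvP i) => _ [].
  have := DP; rewrite mulrCA [D * _]mulrDr mulr1 [D * L]mulrC; lra.
rewrite mulr_sumr -big_split /=; apply: ler_sum => i _.
have [cu [uv vd]] := uvP i.
rewrite (_ : _ - _ = (f (v i) - f (u i)) + (g (v i) - g (u i))); last by ring.
by apply: le_trans (ler_normD _ _) _; rewrite lerD2l; exact: gL.
Qed.

Lemma C1_lipschitz (R : realType) (g dg : R -> R) (c d : R) :
  c <= d -> (forall t, t \in `]c, d[ -> is_derive t 1 g (dg t)) ->
  {within `[c, d], continuous g} -> {within `[c, d], continuous dg} ->
  exists2 L, 0 <= L & forall u v, c <= u -> u <= v -> v <= d ->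
    `|g v - g u| <= L * (v - u).
Proof.
move=> cd dgP cg cdg.
have [|t0 _ tmax] := @EVT_max R (fun t => `|dg t|) c d cd.
  by move=> t; apply: continuous_comp; [exact: cdg | exact: norm_continuous].
exists `|dg t0| => // u v cu uv vd.
have duv t : t \in `]u, v[ -> is_derive t 1 g (dg t).
  move=> tin; apply: dgP; move: tin; rewrite !in_itv /= => /andP[? ?].
  by apply/andP; split; lra.
have cuv : {within `[u, v], continuous g}.
  apply: continuous_subspaceW cg => t /=; rewrite !in_itv /= => /andP[? ?].
  by apply/andP; split; lra.
have [t tin ->] := MVT_segment uv duv cuv.
rewrite normrM [`|v - u|]ger0_norm ?subr_ge0 // ler_wpM2r ?subr_ge0 //.
apply: tmax; move: tin; rewrite !in_itv /= => /andP[? ?].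
by apply/andP; split; lra.
Qed.

(** Were [z d] positive, [z] would be positive on []e, d]] after its last nonpositive time [e]; the
    derivative is then nonpositive a.e. there, and monotonicity gives [z d <= z e <= 0]. *)
Lemma abs_continuous_barrier (R : realType) (z : R -> R) (c d : R) :
  c <= d -> abs_continuous c d z -> z c <= 0 ->
  {ae @lebesgue_measure R, forall t, c < t -> t < d -> 0 < z t ->
    derivable z t 1 /\ (z^`())%classic t <= 0} ->
  z d <= 0.
Proof.
move=> cd ac zc0 zP; rewrite leNgt; apply/negP => zd.
(* [sup A] is the last time at which [z] is nonpositive. *)
pose A := [set t | [/\ c <= t, t <= d & z t <= 0]].
have hA : has_ubound A by exists d => t [].
have Ac : A c by [].
have supA : has_sup A by split; first by exists c.
set e := sup A.
have ce : c <= e by apply: ub_le_sup.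
have ed : e <= d by apply: ge_sup; [exists c | move=> t []].
have ze : z e <= 0.
  (* By continuity a positive value at [e] would persist slightly to the left, where [A] has
     points. *)
  rewrite leNgt; apply/negP => ze0.
  have [delta delta0 H] := abs_continuous_uniform ac ze0.
  have [t [ct td zt] et] := sup_adherent delta0 supA.
  have te : t <= e by apply: ub_le_sup.
  have := H t e ct te ed; rewrite ltr_norml => H'.
  have /andP[_] : - z e < z e - z t < z e by apply: H'; rewrite /e; lra.
  lra.
have zgt0 t : e < t -> t <= d -> 0 < z t.
  move=> et td; rewrite ltNge; apply/negP => zt.
  have At : A t by split=> //; lra.
  by have := ub_le_sup hA At; rewrite leNgt et.
suff : z d <= z e by lra.
apply: abs_continuous_derive_le0 => //.
  move=> r r0; have [delta delta0 H] := ac r r0; exists delta => // n u v uvP.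
  by apply: H => i; have [? [? ?]] := uvP i; split; [lra | split; lra].
apply: (@filterS _ _ (ae_filter_ringOfSetsType _) _ _ _ zP) => t H et td.
by apply: H => //; [exact: le_lt_trans et | apply: zgt0 => //; exact: ltW].
Qed.

(** * Derivatives on a half-line *)

Lemma has_derivative_on_is_derive (R : realType) (s t : R) (x v : R -> R) :
  has_derivative_on `[s, +oo[ x v -> s < t -> is_derive t 1 x (v t).
Proof.
move=> dx st; have tin : `[s, +oo[%classic t by rewrite /= in_itv /= andbT ltW.
suff H : h^-1 *: ((x \o shift t) (h *: 1) - x t) @[h --> 0^'] --> v t.
  by split; [apply/cvg_ex; exists (v t) | exact: cvg_lim].
apply/cvgrPdist_lt => e e0.
have /cvgrPdist_lt /(_ e e0) [eta /= eta0 H] := dx t tin.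
(* The bound [t - s] keeps [t + h] inside the half-line, so the restriction to it disappears. *)
exists (Num.min eta (t - s)); first by rewrite /= lt_min eta0 subr_gt0.
move=> h /=; rewrite sub0r normrN lt_min => /andP[h1 h2] h0.
have := H (h + t); rewrite /ball_ /= opprD addrCA subrr addr0 normrN => /(_ h1).
rewrite in_itv /= andbT -subr_eq0 addrK => /(_ h0).
rewrite /GRing.scale /= mulr1 mulrC; apply.
by move: h2; rewrite ltr_norml => /andP[]; lra.
Qed.

Lemma has_derivative_on_within_continuous (R : realType) (s : R)
    (x v : R -> R) :
  has_derivative_on `[s, +oo[ x v -> {within `[s, +oo[, continuous x}.
Proof.
move=> dx; apply/subspace_continuousP => t tin.
apply/cvgrPdist_lt => e e0.
have /cvgrPdist_lt /(_ 1 ltr01) [eta /= eta0 H] := dx t tin.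
(* Near [t] the difference quotient is within 1 of [v t], so [|v t| + 1] serves as a Lipschitz
   constant at [t]. *)
have L0 : 0 < `|v t| + 1 by rewrite ltr_wpDl.
exists (Num.min eta (e / (`|v t| + 1))); first by rewrite /= lt_min eta0 divr_gt0.
move=> u /=; rewrite lt_min => /andP[u1 u2] uin.
have [->|ut] := eqVneq u t; first by rewrite subrr normr0.
have /= := H u u1 ut uin; set q := (x u - x t) / (u - t) => qv.
have -> : x t - x u = q * (t - u).
  by rewrite -[t - u]opprB mulrN divfK ?subr_eq0 // opprB.
rewrite normrM; move: u2; rewrite ltr_pdivlMr // mulrC; apply: le_lt_trans.
apply: ler_wpM2r => //; have := ler_normB (v t) (v t - q); rewrite subKr; lra.
Qed.

(** * Affine barriers for the velocity *)

Lemma is_derive_affine (R : realType) (c p m t : R) :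
  is_derive t 1 (fun r => p - m * (r - c)) (- m).
Proof.
rewrite (_ : (fun _ => _) = (fun=> p) - m \*: (id - (fun=> c))) //.
by apply: is_derive_eq; rewrite sub0r subr0 /GRing.scale /= mulr1.
Qed.

(** Inside the segment [k x] has derivative [k v - m x], which is continuous up to the endpoints;
    hence [k x] is Lipschitz, and subtracting it preserves the absolute continuity of [v]. *)
Lemma abs_continuous_affine_comb (R : realType) (s c d p m : R)
    (x v : R -> R) :
  has_derivative_on `[s, +oo[ x v -> locally_abs_continuous `[s, +oo[ v ->
  s <= c -> c <= d ->
  abs_continuous c d (v \- ((fun t => p - m * (t - c)) \* x)).
Proof.
move=> dx acv sc cd; set k := fun t => p - m * (t - c).
have sub : `[c, d] `<=` `[s, +oo[.
  by move=> t /=; rewrite !in_itv /= andbT => /andP[ct _]; exact: le_trans ct.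
have ac := acv c d sub.
have ck : continuous k.
  move=> t; apply: differentiable_continuous; apply/derivable1_diffP.
  have dkt : is_derive t 1 k (- m) := is_derive_affine c p m t.
  exact: ex_derive.
have cx : {within `[c, d], continuous x}.
  exact: continuous_subspaceW sub (has_derivative_on_within_continuous dx).
have cv := abs_continuous_within_continuous ac.
have dkx t : t \in `]c, d[ -> is_derive t 1 (k \* x) (k t * v t + x t * - m).
  rewrite in_itv /= => /andP[ct _].
  have dxt := has_derivative_on_is_derive dx (le_lt_trans sc ct).
  exact: is_deriveM (is_derive_affine c p m t) dxt.
have ckx : {within `[c, d], continuous (k \* x)}.
  by move=> t; apply: continuousM; [exact: continuous_subspaceT | exact: cx].
have ckv : {within `[c, d], continuous (k \* v)}.
  by move=> t; apply: continuousM; [exact: continuous_subspaceT | exact: cv].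
have cxm : {within `[c, d], continuous (x \* (fun=> - m))}.
  by move=> t; apply: continuousM; [exact: cx | exact: cvg_cst].
have [L L0 H] := C1_lipschitz cd dkx ckx (within_continuousD ckv cxm).
apply: (abs_continuousD_lipschitz ac L0) => y z cy yz zd.
by rewrite -opprD normrN; exact: H.
Qed.

(** A.e. the derivative of [z = v - k x] is [- (a + k) v - (b - m) x]. If [v >= 0], both terms are
    nonpositive because [a >= alpha >= c >= - k] and [b >= beta >= m]. If [v < 0] and [z > 0], the
    slope bound leaves [b - m >= beta / 2], enough to dominate [- a v]. *)
Lemma velocity_barrier (R : realType) (a b x v : R -> R)
    (s alpha beta M c m p t1 t2 : R) :
  has_derivative_on `[s, +oo[ x v -> locally_abs_continuous `[s, +oo[ v ->
  {ae @lebesgue_measure R, forall t, s <= t ->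
    [/\ derivable v t 1, (v^`())%classic t + a t * v t + b t * x t = 0,
        alpha <= a t, a t <= M & beta <= b t]} ->
  (forall t, s < t -> 0 < x t) ->
  0 <= alpha -> 0 <= c -> c <= alpha -> M * c <= beta / 2 ->
  0 <= m -> m <= beta / 2 ->
  s <= t1 -> t1 <= t2 -> - c <= p - m * (t2 - t1) ->
  v t1 <= p * x t1 -> v t2 <= (p - m * (t2 - t1)) * x t2.
Proof.
move=> dx acv eqn xpos alpha0 c0 calpha Mc m0 mbeta st1 t12 kc v1.
set k := fun t => p - m * (t - t1).
have ac := abs_continuous_affine_comb p m dx acv st1 t12.
suff : (v \- (k \* x)) t2 <= 0 by rewrite /= /k subr_le0.
apply: (abs_continuous_barrier t12 ac).
  by rewrite /= /k subrr mulr0 subr0 subr_le0.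
apply: (@filterS _ _ (ae_filter_ringOfSetsType _) _ _ _ eqn) => t H t1t tt2.
have st : s < t by exact: le_lt_trans t1t.
have [dv eqt at1 at2 bt] := H (ltW st).
have dxt := has_derivative_on_is_derive dx st.
have dz : is_derive t 1 (v \- (k \* x))
    ((v^`())%classic t - (k t * v t + x t * - m)).
  rewrite derive1E.
  exact: is_deriveB (derivableP dv) (is_deriveM (is_derive_affine t1 p m t) dxt).
rewrite /= subr_gt0 -/(k t) => zt; split; first exact: ex_derive.
rewrite derive1E derive_val.
(* [k] is nonincreasing, so its lower bound at [t2] holds throughout. *)
have kt : - c <= k t.
  apply: le_trans kc _; rewrite /k lerD2l lerN2 ler_wpM2l //; lra.
have xt := xpos t st.
have -> : (v^`())%classic t = - a t * v t - b t * x t by move: eqt; lra.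
(* If [v t < 0] then [k t < 0] and [- a v <= M c x <= beta / 2 * x]. *)
have [v0|v0] := leP 0 (v t).
  have : 0 <= (a t + k t) * v t by apply: mulr_ge0 => //; lra.
  have : 0 <= (b t - m) * x t by apply: mulr_ge0; lra.
  lra.
have k0 : k t < 0.
  by rewrite ltNge; apply/negP => k0; have := mulr_ge0 k0 (ltW xt); lra.
(* The six nonnegative products add up to [(a + k) v + (b - m) x], minus the derivative of [z]. *)
have : 0 <= (M - a t) * - v t by apply: mulr_ge0; lra.
have : 0 <= (- k t) * - v t by apply: mulr_ge0; lra.
have : 0 <= (b t - m - beta / 2) * x t by apply: mulr_ge0; lra.
have : 0 <= (beta / 2 - M * c) * x t by apply: mulr_ge0; lra.
have : 0 <= M * ((k t + c) * x t) by rewrite !mulr_ge0 //; lra.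
have : 0 <= M * (v t - k t * x t) by rewrite mulr_ge0 //; lra.
lra.
Qed.

(** * Decay of positive solutions *)

Lemma has_derivative_on_MVT (R : realType) (s u t : R) (x v : R -> R) :
  has_derivative_on `[s, +oo[ x v -> s <= u -> u <= t ->
  exists2 r, u <= r <= t & x t - x u = v r * (t - u).
Proof.
move=> dx su ut.
have dxr r : r \in `]u, t[ -> is_derive r 1 x (v r).
  rewrite in_itv /= => /andP[ur _].
  exact: has_derivative_on_is_derive dx (le_lt_trans su ur).
have cx : {within `[u, t], continuous x}.
  apply: continuous_subspaceW (has_derivative_on_within_continuous dx) => r /=.
  by rewrite !in_itv /= andbT => /andP[ur _]; exact: le_trans ur.
by have [r rin ->] := MVT_segment ut dxr cx; exists r; move: rin; rewrite ?in_itv.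
Qed.

(** By the zero barrier a nonpositive velocity stays nonpositive; so [v t > 0] forces [v > 0] on
    [[s, t]], where the equation makes [v' = - a v - b x] nonpositive a.e. *)
Lemma positive_velocity_nonincreasing (R : realType) (a b x v : R -> R)
    (s alpha beta M : R) :
  has_derivative_on `[s, +oo[ x v -> locally_abs_continuous `[s, +oo[ v ->
  {ae @lebesgue_measure R, forall t, s <= t ->
    [/\ derivable v t 1, (v^`())%classic t + a t * v t + b t * x t = 0,
        alpha <= a t, a t <= M & beta <= b t]} ->
  (forall t, s < t -> 0 < x t) -> 0 <= alpha -> 0 <= beta ->
  forall r t, s <= r -> r <= t -> 0 < v t -> v t <= v r.
Proof.
move=> dx acv eqn xpos alpha0 beta0 r t sr rt vt.
have vpos u : s <= u -> u <= t -> 0 < v u.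
  move=> su ut; rewrite ltNge; apply/negP => vu; move: vt; apply/negP.
  have := @velocity_barrier R a b x v s alpha beta M 0 0 0 u t dx acv eqn xpos.
  by rewrite !(mul0r, mulr0, subr0, oppr0) -leNgt; apply => //; lra.
apply: abs_continuous_derive_le0 => //.
  apply: acv => u /=; rewrite !in_itv /= andbT => /andP[ru _]; exact: le_trans ru.
apply: (@filterS _ _ (ae_filter_ringOfSetsType _) _ _ _ eqn) => u H ru ut.
have su : s < u by exact: le_lt_trans ru.
have [dv eqt at1 at2 bt] := H (ltW su); split=> //.
have := vpos u (ltW su) (ltW ut); have := xpos u su => xu vu.
have : 0 <= a u * v u by apply: mulr_ge0; lra.
have : 0 <= b u * x u by apply: mulr_ge0; lra.
lra.
Qed.

(** [T] is one unit of time to reach [v <= x], plus the time a barrier of slope [- beta / 2] takes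
    to descend from 1 to [- c]. Up to [s + T] the bound [x r <= r - s] suffices. *)
Lemma positive_solution_decay (R : realType) (a b x v : R -> R)
    (s alpha beta M c : R) :
  has_derivative_on `[s, +oo[ x v -> locally_abs_continuous `[s, +oo[ v ->
  {ae @lebesgue_measure R, forall t, s <= t ->
    [/\ derivable v t 1, (v^`())%classic t + a t * v t + b t * x t = 0,
        alpha <= a t, a t <= M & beta <= b t]} ->
  (forall t, s < t -> 0 < x t) -> x s = 0 -> v s = 1 ->
  0 <= alpha -> 0 < beta -> 0 <= c -> c <= alpha -> M * c <= beta / 2 ->
  let T := 1 + (1 + c) / (beta / 2) in
  forall t, s <= t -> x t <= T * expR (c * T) * expR (- c * (t - s)).
Proof.
move=> dx acv eqn xpos xs vs alpha0 beta0 c0 calpha Mc T t st.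
have b2 : 0 < beta / 2 by lra.
have c1 : 0 < (1 + c) / (beta / 2) by apply: divr_gt0; lra.
have vdec := positive_velocity_nonincreasing dx acv eqn xpos alpha0 (ltW beta0).
have v1 r : s <= r -> v r <= 1.
  move=> sr; have [v0|v0] := leP (v r) 0; first by lra.
  by rewrite -vs; exact: vdec.
have x1 r : s <= r -> x r <= r - s.
  move=> sr; have [q /andP[sq qr]] := has_derivative_on_MVT dx (lexx s) sr.
  rewrite xs subr0 => ->; rewrite -[leRHS]mul1r ler_wpM2r ?v1 //; lra.
have vx1 : v (s + 1) <= 1 * x (s + 1).
  have s1 : s < s + 1 by lra.
  have := xpos _ s1; rewrite mul1r.
  have [v0|v0] := leP (v (s + 1)) 0; first by lra.
  (* A positive [v (s + 1)] is at most the velocity at a mean value point, which equals [x (s + 1)]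
     because [x s = 0] and the interval has length 1. *)
  have [q /andP[sq qr]] := has_derivative_on_MVT dx (lexx s) (ltW s1).
  have := vdec q (s + 1) sq qr v0.
  by rewrite xs subr0 addrAC subrr add0r mulr1 => + ->.
have vxT : v (s + T) <= - c * x (s + T).
  have k1 : 1 - beta / 2 * (s + T - (s + 1)) = - c.
    by rewrite /T; field; rewrite gt_eqF.
  rewrite -k1; apply: (velocity_barrier dx acv eqn xpos alpha0 c0) => //;
    rewrite ?k1 /T; lra.
have vx r : s + T <= r -> v r <= - c * x r.
  move=> Tr.
  (* Once reached, the level [- c] is kept by a barrier of slope zero. *)
  have k0 : - c - 0 * (r - (s + T)) = - c by ring.
  rewrite -k0; apply: (velocity_barrier dx acv eqn xpos alpha0 c0) => //;
    rewrite ?k0 /T; lra.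
have T0 : 0 < T by rewrite /T; lra.
suff : x t * expR (c * (t - s)) <= T * expR (c * T).
  by rewrite mulNr expRN ler_pdivlMr ?expR_gt0.
have small r : s <= r -> r <= s + T ->
    x r * expR (c * (r - s)) <= T * expR (c * T).
  move=> sr rT; apply: (@le_trans _ _ (T * expR (c * (r - s)))).
    by rewrite ler_pM2r ?expR_gt0 //; have := x1 r sr; lra.
  by rewrite ler_pM2l // ler_expR ler_wpM2l //; lra.
have [tT|/ltW tT] := leP t (s + T); first exact: small.
have sT : s <= s + T by lra.
apply: le_trans (small _ sT (lexx _)).
pose E r := expR (c * (r - s)).
have dE (r : R) : is_derive r 1 E (E r * c).
  pose h q : R := 0 - - c * (q - s).
  have dh : is_derive r 1 h (- - c) := is_derive_affine s 0 (- c) r.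
  have -> : E = expR \o h.
    by apply/funext => q; rewrite /E /h /= sub0r mulNr opprK.
  have := @is_derive1_comp R expR h r _ _ (is_derive_expR (h r)) dh.
  by rewrite opprK.
pose g := x \* E.
have dg (r : R) : r \in `]s + T, t[ -> is_derive r 1 g (x r * (E r * c) + E r * v r).
  rewrite in_itv /= => /andP[Tr _].
  have dxr := has_derivative_on_is_derive dx (le_lt_trans sT Tr).
  exact: is_deriveM dxr (dE r).
have cE : continuous E.
  move=> r; apply: differentiable_continuous; apply/derivable1_diffP.
  have := dE r => dEr; exact: ex_derive.
have cg : {within `[s + T, t], continuous g}.
  move=> r; apply: continuousM; last exact: continuous_subspaceT.
  apply: continuous_subspaceW (has_derivative_on_within_continuous dx) r => r /=.
  by rewrite !in_itv /= andbT => /andP[Tr _]; exact: le_trans Tr.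
have [r rin H] := MVT_segment tT dg cg.
rewrite -subr_le0 [leLHS]H; move: rin; rewrite in_itv /= => /andP[Tr rt].
(* The derivative of [x E] is [E * (v + c x)], and [vx] gives its sign. *)
have -> : x r * (E r * c) + E r * v r = E r * (v r - - c * x r) by ring.
rewrite mulr_le0_ge0 ?subr_ge0 // mulr_ge0_le0 ?expR_ge0 // subr_le0.
exact: vx.
Qed.

(** * Uniform constants for the fundamental function *)

Theorem theorem6 (R : realType) (a b : R -> R) (alpha beta : R)
    (X : R -> R -> R) :
  lebesgue_measurable_fun `[0, +oo[ a ->
  lebesgue_measurable_fun `[0, +oo[ b ->
  essentially_bounded `[0, +oo[ a ->
  essentially_bounded `[0, +oo[ b ->
  0 < alpha ->
  0 < beta ->
  {ae @lebesgue_measure R, forall t, 0 <= t -> alpha <= a t} ->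
  {ae @lebesgue_measure R, forall t, 0 <= t -> beta <= b t} ->
  is_fundamental_function a b X ->
  (forall t s : R, 0 <= s -> s < t -> 0 < X t s) ->
  exponentially_stable X.
Proof.
move=> _ _ [M0 aM] _ alpha0 beta0 aalpha bbeta XP Xpos.
(* The [+ 1] makes [M] positive, so that [c] can be the largest number with [c <= alpha] and
   [M * c <= beta / 2]; neither depends on [s]. *)
pose M := `|M0| + 1; have M1 : 0 < M by rewrite ltr_wpDl.
pose c := Num.min alpha (beta / 2 / M).
have c0 : 0 < c by rewrite lt_min alpha0 !divr_gt0.
have calpha : c <= alpha by rewrite ge_min lexx.
have Mc : M * c <= beta / 2 by rewrite mulrC -ler_pdivlMr // ge_min lexx orbT.
pose T := 1 + (1 + c) / (beta / 2).
have T0 : 0 < T by rewrite addr_gt0 // !divr_gt0 // addr_gt0.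
exists (T * expR (c * T)), c; split=> //; first by rewrite mulr_gt0 ?expR_gt0.
move=> t s s0 st.
have [v [dx acv eqv] [xs vs]] := XP s s0.
have xpos r : s < r -> 0 < X r s by exact: Xpos.
(* Positivity covers [t > s] only; at [t = s] the value is zero. *)
rewrite ger0_norm; last first.
  have [<-|ts] := eqVneq s t; first by rewrite xs.
  by apply/ltW/xpos; rewrite lt_neqAle ts.
apply: (@positive_solution_decay R a b (X^~ s) v s alpha beta M c) => //; try exact: ltW.
have ab := @filterI _ _ (ae_filter_ringOfSetsType _) _ _ aalpha bbeta.
apply: (@filterS3 _ _ (ae_filter_ringOfSetsType _) _ _ _ _ _ eqv aM ab).
move=> r Hv Ha [Haa Hb] sr; have r0 := le_trans s0 sr.
have [dv ev] := Hv sr; split=> //; [exact: Haa | | exact: Hb].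
have := Ha; rewrite /= in_itv /= andbT => /(_ r0); have := ler_norm (a r).
have := ler_norm M0; rewrite /M; lra.
Qed.
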